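(* Every odometer $(X,T)$ is conjugate to a homeomorphism $\mathfrak{f}\colon C\to C$, where $C\subseteq\mathbb{R}$, such that $\mathfrak{f}'(x)=0$ for every $x\in C$ and $\mathfrak{f}$ extends to a differentiable surjection $\bar{\mathfrak{f}}\colon\mathbb{R}\to\mathbb{R}$.
   Context: A dynamical system is a pair $(X,T)$ with $X$ a compact metric space and $T\colon X\to X$ continuous. A point $x\in X$ is regularly recurrent if for every open $U\ni x$ there is $n\geq 1$ with $T^{in}(x)\in U$ for all $i=0,1,2,\ldots$. $(X,T)$ is equicontinuous if for every $\varepsilon>0$ there is $\delta>0$ such that $d(x,y)<\delta$ implies $d(T^n x,T^n y)<\varepsilon$ for all $n\geq 0$. $(X,T)$ is an odometer if it is equicontinuous and there is a regularly recurrent point whose orbit is dense in $X$. Two systems $(X,T)$, $(Y,S)$ are conjugate if there is a homeomorphism $h\colon X\to Y$ with $h\circ T=S\circ h$. For $C\subseteq\mathbb{R}$ and $f\colon C\to C$, the derivative at $x\in C$ is $f'(x)=\lim_{y\to x,\,y\in C\setminus\{x\}}\frac{f(y)-f(x)}{y-x}$. *)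

(* Defs.v *)
From HB Require Import structures.
From mathcomp Require Import all_boot all_order all_algebra.
From mathcomp Require Import all_classical all_reals all_analysis.
Set Implicit Arguments. Unset Strict Implicit. Unset Printing Implicit Defensive.
Import Order.TTheory GRing.Theory Num.Theory.
Import numFieldNormedType.Exports.
Local Open Scope classical_set_scope.
Local Open Scope ring_scope.

(* A compact metric space is modelled as a Hausdorff pseudometric space
   (X : pseudoMetricType R) with [set: X] compact. *)

Definition regularly_recurrent {R : realType} (X : pseudoMetricType R)
  (T : X -> X) (x : X) : Prop :=
  forall U : set X, open U -> U x ->
    exists2 n : nat, (1 <= n)%N & forall i : nat, U (iter (i * n) T x).

Definition equicontinuous_sys {R : realType} (X : pseudoMetricType R)
  (T : X -> X) : Prop :=
  forall eps : R, 0 < eps -> exists2 delta : R, 0 < delta &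
    forall x y : X, ball x delta y ->
      forall n : nat, ball (iter n T x) eps (iter n T y).

Definition dense_orbit {R : realType} (X : pseudoMetricType R)
  (T : X -> X) (x : X) : Prop :=
  closure (range (fun n : nat => iter n T x)) = [set: X].

Definition odometer {R : realType} (X : pseudoMetricType R) (T : X -> X) : Prop :=
  [/\ hausdorff_space X, compact [set: X], continuous T,
      equicontinuous_sys T &
      exists x : X, regularly_recurrent T x /\ dense_orbit T x].

Definition homeo_onto {R : realType} (X : pseudoMetricType R)
  (h : X -> R) (C : set R) : Prop :=
  [/\ range h = C, injective h, continuous h &
      exists g : R -> X, (forall x, g (h x) = x) /\ {within C, continuous g}].

Definition homeo_of_subset {R : realType} (f : R -> R) (C : set R) : Prop :=
  [/\ f @` C = C, {in C &, injective f}, {within C, continuous f} &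
      exists g : R -> R, [/\ {in C, cancel f g}, g @` C `<=` C &
                             {within C, continuous g}]].

Definition deriv_on_zero {R : realType} (f : R -> R) (C : set R) (x : R) : Prop :=
  (fun y => (f y - f x) / (y - x)) @ within (C `\ x) (nbhs x) --> (0 : R).

(* Main.v *)
(** An odometer carries residues [i n x] modulo integers [p n], with [p n]
    dividing [p n.+1], which together separate points and satisfy
    [i n (T x) = i n x + 1]: they number the closures of the orbits under a
    suitable power of [T].  Rotate the residues modulo [p n] into positions
    [0, ..., p n - 1] and put
      [h x = \sum_n 2 ^- (block_start n + (n + 2) * position n x)].
    If [x] and [y] are first distinguished at level [n], then [|h x - h y|] is
    comparable to the larger of the two terms of index [n], and [T] multiplies
    that term by [2 ^- (n + 2)], except on the single residue class whose
    position wraps around to [0].  These exceptional classes are chosen so that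
    each point is affected at finitely many levels only, hence the conjugate [f]
    of [T] has derivative [0] on [C = h(X)].

    Adjoin to [C] the integers [k] with [|k| >= 3], with [f k = k], and
    interpolate [f] on each gap by [3 u^2 - 2 u^3].  A point close to [x] on the
    near part of a gap barely sees the far endpoint, because [3 u^2 - 2 u^3] is
    [O(u^2)]; so the interpolation is differentiable, and it is onto by the
    intermediate value theorem. *)
Require Import Defs.
From HB Require Import structures.
From mathcomp Require Import all_boot all_order all_algebra.
From mathcomp Require Import all_classical all_reals all_analysis.
From mathcomp Require Import ring lra zify.
Import Order.TTheory GRing.Theory Num.Theory.
Import numFieldNormedType.Exports.
Local Open Scope classical_set_scope.
Local Open Scope ring_scope.

Set Implicit Arguments. Unset Strict Implicit. Unset Printing Implicit Defensive.

(** * Residues of an odometer *)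

Lemma hausdorff_ball_eq (R : realType) (X : pseudoMetricType R) (x y : X) :
  hausdorff_space X -> (forall e : R, 0 < e -> ball x e y) -> x = y.
Proof.
move=> hX H; apply: hX => U V /nbhs_ballP[e /= e0 eU] Vy.
by exists y; split; [apply: eU; exact: H|exact: nbhs_singleton].
Qed.

(** * Closures of orbits under powers of [T] *)

Section OrbitClosureClasses.
Variables (R : realType) (X : pseudoMetricType R) (T : X -> X) (x0 : X).
Hypothesis eqT : equicontinuous_sys T.
Hypothesis rec0 : regularly_recurrent T x0.
Hypothesis dense0 : dense_orbit T x0.

Lemma orbit_dense (x : X) (B : set X) : nbhs x B -> exists n, B (iter n T x0).
Proof.
move=> xB; have : closure (range (fun n => iter n T x0)) x by rewrite dense0.
by move=> /(_ _ xB)[_ [[n _ <-] Bn]]; exists n.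
Qed.

(** The almost period [q] of [x0] serves every [x]: by density [x] is close to some [T^n x0], by
    equicontinuity their iterates stay close, and [T^n] commutes with [T^(i q)]. *)
Lemma uniform_almost_period (e : R) : 0 < e ->
  exists2 q : nat, (0 < q)%N & forall x i, ball x e (iter (i * q) T x).
Proof.
move=> e0; have e30 : 0 < e / 3 by lra.
have [d d0 Hd] := eqT e30.
have [q q0 Hq] : exists2 q : nat, (0 < q)%N & forall i, ball x0 d (iter (i * q) T x0).
  have [q q0 Hq] := rec0 (@open_interior _ (ball x0 d)) (nbhsx_ballx x0 d d0).
  by exists q => // i; exact: interior_subset (Hq i).
exists q => // x i.
have [n [xn xn']] : exists n, ball x (e / 3) (iter n T x0) /\ ball x d (iter n T x0).
  apply: (@orbit_dense x (ball x (e / 3) `&` ball x d)).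
  by apply: filterI; exact: nbhsx_ballx.
rewrite (_ : e = e / 3 + (e / 3 + e / 3)); last by field.
apply: (ball_triangle xn); apply: (@ball_triangle _ _ (iter (i * q) T (iter n T x0))).
  by rewrite -iterD addnC iterD; exact: Hd.
by apply: ball_sym; exact: Hd.
Qed.

(* [orbit_class q x y]: [y] lies in the closure of the [T^q]-orbit of [x]. *)
Definition orbit_class (q : nat) (x y : X) : Prop :=
  forall e : R, 0 < e -> exists i, ball (iter (i * q) T x) e y.

Lemma orbit_class_iter q i x : orbit_class q x (iter (i * q) T x).
Proof. by move=> e e0; exists i; exact: ballxx. Qed.

Lemma orbit_classxx q x : orbit_class q x x.
Proof. exact: (orbit_class_iter q 0). Qed.

Lemma orbit_class_image q n x y :
  orbit_class q x y -> orbit_class q (iter n T x) (iter n T y).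
Proof.
move=> xy e e0; have [d d0 Hd] := eqT e0.
have [i xyi] := xy d d0; exists i.
by rewrite -iterD addnC iterD; exact: Hd.
Qed.

Lemma orbit_class_trans q y x z :
  orbit_class q x y -> orbit_class q y z -> orbit_class q x z.
Proof.
move=> xy yz e e0; have e20 : 0 < e / 2 by lra.
have [d d0 Hd] := eqT e20.
have [i xyi] := xy d d0; have [j yzj] := yz _ e20.
exists (j + i)%N; rewrite mulnDl iterD [e]splitr.
by apply: ball_triangle yzj; exact: Hd.
Qed.

Lemma orbit_class_sym q x y : orbit_class q x y -> orbit_class q y x.
Proof.
move=> xy e e0; have e20 : 0 < e / 2 by lra.
have [d d0 Hd] := eqT e20.
have [i xyi] := xy d d0.
have [r r0 Hr] := uniform_almost_period e20.
(* The [i * q] steps from [x] to near [y] are completed to [i * q * r] steps, a multiple of the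
   almost period [r], which lead back near [x]. *)
exists (i * r - i)%N; apply: ball_sym; rewrite [e]splitr.
apply: (ball_triangle (Hr x (i * q)%N)).
rewrite (_ : (i * q * r = (i * r - i) * q + i * q)%N); last by nia.
by rewrite iterD; exact: Hd.
Qed.

(** A further [n * q - n] steps turn [T^n] into a power of [T^q], which keeps each point in its
    class. *)
Lemma orbit_class_iter_inj q n x y : (0 < q)%N ->
  orbit_class q (iter n T x) (iter n T y) -> orbit_class q x y.
Proof.
move=> q0 xy; apply: (orbit_class_trans (orbit_class_iter q n x)).
apply: (@orbit_class_trans _ (iter (n * q) T y)); last first.
  by apply: orbit_class_sym; exact: orbit_class_iter.
rewrite (_ : (n * q = (n * q - n) + n)%N); last by nia.
by rewrite !iterD; exact: orbit_class_image.
Qed.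

Lemma orbit_class_dvd q r x y :
  (q %| r)%N -> orbit_class r x y -> orbit_class q x y.
Proof.
move=> /dvdnP[k ->] xy e e0; have [i xyi] := xy e e0.
by exists (i * k)%N; rewrite -mulnA.
Qed.

Lemma orbit_class_closed q x y :
  ~ orbit_class q x y -> \forall z \near y, ~ orbit_class q x z.
Proof.
move=> xy; apply: contrapT => H; apply: xy => e e0.
have e20 : 0 < e / 2 by lra.
apply: contrapT => K; apply: H; near=> z => xz; apply: K.
have [i xzi] := xz _ e20; exists i; rewrite [e]splitr.
apply: (ball_triangle xzi); apply: ball_sym.
by near: z; exact: nbhsx_ballx.
Unshelve. all: by end_near. Qed.

(** These finitely many classes are closed and, reducing exponents modulo [q], contain the dense
    orbit of [x0]. *)
Lemma orbit_class_cover q x : (0 < q)%N ->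
  exists k : 'I_q, orbit_class q (iter k T x0) x.
Proof.
move=> q0; apply: contrapT => /forallNP H.
have : \forall z \near x, forall k : 'I_q, ~ orbit_class q (iter k T x0) z.
  by apply: filter_forall => k; exact: orbit_class_closed.
move=> /orbit_dense[n] /(_ (Ordinal (ltn_pmod n q0))); apply.
have -> : iter n T x0 = iter (n %/ q * q) T (iter (n %% q) T x0).
  by rewrite -iterD -divn_eq.
exact: orbit_class_iter.
Qed.

(** A class is the complement of finitely many closed classes. *)
Lemma orbit_class_open q x : (0 < q)%N -> \forall y \near x, orbit_class q x y.
Proof.
move=> q0.
have : \forall y \near x, forall k : 'I_q,
    orbit_class q (iter k T x0) y -> orbit_class q (iter k T x0) x.
  apply: filter_forall => k.
  have [?|/orbit_class_closed nx] := pselect (orbit_class q (iter k T x0) x).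
    by near=> y.
  by near=> y => ky; exfalso; move: ky; near: y.
apply: filterS => y xy; have [k ky] := orbit_class_cover y q0.
exact: orbit_class_trans (orbit_class_sym (xy _ ky)) ky.
Unshelve. all: by end_near. Qed.

(** The return times [S] of [x0] to its own class are closed under sums and differences, so they are
    the multiples of the least positive one, [p]. It can be smaller than [q], since the classes of
    different iterates may coincide. *)
Lemma orbit_class_residue q : (0 < q)%N -> exists (p : nat) (i : X -> nat),
  (0 < p)%N /\ forall k x, orbit_class q (iter k T x0) x <-> i x = (k %% p)%N.
Proof.
move=> q0; pose S k := orbit_class q x0 (iter k T x0).
have SD a b : S a -> S b -> S (a + b)%N.
  move=> Sa /orbit_class_trans; apply; rewrite addnC iterD.
  exact: orbit_class_image.
have SB a b : S a -> S (a + b)%N -> S b.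
  move=> Sa /orbit_class_trans; apply; rewrite addnC iterD.
  by apply: orbit_class_sym; exact: orbit_class_image.
have ex_p : exists p, (0 < p)%N && `[< S p >].
  exists q; rewrite q0; apply/asboolP.
  by rewrite /S -[q in iter q](mul1n q); exact: orbit_class_iter.
have [p /andP[p0 /asboolP Sp] pmin] := ex_minnP ex_p.
have Smul m : S (m * p)%N.
  elim: m => [|m IH]; first by rewrite mul0n; exact: orbit_classxx.
  by rewrite mulSn; exact: SD.
have Sdvd k : S k <-> (p %| k)%N.
  split=> [Sk|/dvdnP[m ->]//].
  have Sr : S (k %% p)%N by apply: (SB (k %/ p * p)%N) => //; rewrite -divn_eq.
  rewrite /dvdn; case: posnP => // r0.
  have := pmin (k %% p)%N; rewrite r0 (asboolT Sr) => /(_ isT).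
  by rewrite leqNgt ltn_pmod.
have SE k m : orbit_class q (iter k T x0) (iter (m + k) T x0) <-> (p %| m)%N.
  rewrite -Sdvd addnC iterD; split; first exact: orbit_class_iter_inj.
  exact: orbit_class_image.
have modE k l : orbit_class q (iter k T x0) (iter l T x0) <-> (l %% p = k %% p)%N.
  have [kl|/ltnW lk] := leqP k l.
    rewrite -{1}(subnK kl) SE -eqn_mod_dvd//.
    by split=> [/eqP|/eqP].
  rewrite -{1}(subnK lk); split=> [/orbit_class_sym/SE|].
    by rewrite -eqn_mod_dvd// => /eqP.
  by move=> E; apply/orbit_class_sym/SE; rewrite -eqn_mod_dvd// E.
have /choice[f Hf] : forall x, exists k, orbit_class q (iter k T x0) x.
  by move=> x; have [k] := orbit_class_cover x q0; exists k.
exists p, (fun x => f x %% p)%N; split=> // k x; rewrite -modE; split=> H.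
  exact: orbit_class_trans H (orbit_class_sym (Hf x)).
exact: orbit_class_trans H (Hf x).
Qed.

End OrbitClosureClasses.

(** The [i n] form a continuous injection of [X] into the inverse limit of the integers modulo
    [p n], under which [T] becomes addition of 1. *)
Record residue_system {R : realType} (X : pseudoMetricType R) (T : X -> X)
    (p : nat -> nat) (i : nat -> X -> nat) : Prop := ResidueSystem {
  modulus0 : p 0 = 1%N;
  modulus_gt0 : forall n, (0 < p n)%N;
  modulus_dvd : forall n, (p n %| p n.+1)%N;
  residue_lt : forall n x, (i n x < p n)%N;
  residue_step : forall n x, i n (T x) = ((i n x).+1 %% p n)%N;
  residue_mod : forall n x, i n x = (i n.+1 x %% p n)%N;
  residue_near : forall n x, \forall y \near x, i n y = i n x;
  residue_sep : forall x y, (forall n, i n x = i n y) -> x = y }.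

Lemma odometer_residue_system (R : realType) (X : pseudoMetricType R) (T : X -> X) :
  odometer T -> exists p i, residue_system T p i.
Proof.
move=> [hX _ _ eqT [x0 [rec0 dense0]]].
have /choice[a Ha] : forall n : nat, exists q : nat, (0 < q)%N /\
    forall x i, ball x (n.+1%:R^-1 / 2 : R) (iter (i * q) T x).
  move=> n; have e0 : 0 < n.+1%:R^-1 / 2 :> R by rewrite divr_gt0.
  by have [q ? ?] := uniform_almost_period eqT rec0 dense0 e0; exists q.
(* Products make [q n] and [a n] divide [q n.+1]; the empty product [q 0 = 1] yields [p 0 = 1]. *)
pose q n := (\prod_(j < n) a j)%N.
have q0 n : (0 < q n)%N by apply: prodn_gt0 => j; have [] := Ha j.
have /choice[p /choice[i Hi]] n := orbit_class_residue eqT rec0 dense0 (q0 n).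
have p0 n : (0 < p n)%N by have [] := Hi n.
have iE n k x : orbit_class T (q n) (iter k T x0) x <-> i n x = (k %% p n)%N.
  by have [_] := Hi n.
have i_rep n x : exists k, orbit_class T (q n) (iter k T x0) x.
  by have [k kx] := orbit_class_cover dense0 x (q0 n); exists k.
have i0 n : i n x0 = 0%N.
  by rewrite -[RHS](mod0n (p n)); apply/iE; exact: orbit_classxx.
have qS n : (q n %| q n.+1)%N by rewrite /q big_ord_recr dvdn_mulr.
have pS n : (p n %| p n.+1)%N.
  rewrite /dvdn -(i0 n); apply/eqP/esym/iE; apply: orbit_class_dvd (qS n) _.
  by apply/iE; rewrite modnn.
exists p, i; split=> //.
- have : orbit_class T (q 0) (iter 1 T x0) x0.
    apply: (orbit_class_sym eqT rec0 dense0); rewrite /q big_ord0 -[X in iter X](mul1n 1).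
    exact: orbit_class_iter.
  by move=> /iE; rewrite i0 => /esym/eqP; rewrite -/(dvdn _ _) dvdn1 => /eqP.
- by move=> n x; have [k /iE ->] := i_rep n x; rewrite ltn_pmod.
- move=> n x; have [k kx] := i_rep n x.
  have /iE -> : orbit_class T (q n) (iter k.+1 T x0) (T x).
    exact: (orbit_class_image eqT 1 kx).
  by move/iE: kx => ->; rewrite -[in RHS]addn1 modnDml addn1.
- move=> n x; have [k kx] := i_rep n.+1 x.
  have /iE -> := orbit_class_dvd (qS n) kx; move/iE: kx => ->.
  by rewrite modn_dvdm.
- move=> n x; have := orbit_class_open eqT rec0 dense0 x (q0 n).
  apply: filterS => y xy; have [k kx] := i_rep n x.
  by have /iE -> := orbit_class_trans eqT kx xy; move/iE: kx => ->.
- move=> x y xy; apply: hausdorff_ball_eq => // e e0.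
  have [n ne] : exists n : nat, n.+1%:R^-1 < e.
    by have [n _ H] := near_infty_natSinv_lt (PosNum e0); exists n; apply: H => /=.
  have [k kx] := i_rep n.+1 x.
  have ky : orbit_class T (q n.+1) (iter k T x0) y.
    by apply/iE; rewrite -xy; apply/iE.
  have e20 : 0 < n.+1%:R^-1 / 2 :> R by rewrite divr_gt0.
  (* Some iterate of [x] under [T^(q n.+1)] is close to [y], and all of them are close to [x]
     because [a n] divides [q n.+1]. *)
  have [j Hj] := orbit_class_trans eqT (orbit_class_sym eqT rec0 dense0 kx) ky e20.
  apply: (@le_ball _ _ _ (n.+1%:R^-1)); first exact: ltW.
  rewrite [_^-1]splitr; apply: ball_triangle Hj.
  by rewrite /q big_ord_recr mulnA; have [_] := Ha n.
Qed.

(** * The coding map *)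

Section DyadicSums.
Variable R : realType.
Implicit Types E : nat -> nat.

Definition dyadic_partial E (n : nat) : R := \sum_(j < n) 2^-1 ^+ E j.

Definition dyadic_sum E : R := sup (range (dyadic_partial E)).

Lemma dyadic_gt0 k : 0 < 2^-1 ^+ k :> R.
Proof. by rewrite exprn_gt0// invr_gt0. Qed.

Lemma dyadic_small (e : R) : 0 < e -> exists N, 2^-1 ^+ N <= e.
Proof.
move=> e0; have /cvgrPdist_le /(_ _ e0) : (fun n => 2^-1 ^+ n : R) @ \oo --> (0 : R).
  by apply: cvg_expr; rewrite ger0_norm; lra.
move=> [N _ /(_ N (leqnn N))]; rewrite sub0r normrN ger0_norm; first by exists N.
exact/ltW/dyadic_gt0.
Qed.

Lemma dyadic_le k l : (k <= l)%N -> 2^-1 ^+ l <= 2^-1 ^+ k :> R.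
Proof. by move=> kl; rewrite ler_wiXn2l//; lra. Qed.

Lemma dyadic_sum_bounds E m : (forall n, E n < E n.+1)%N ->
  dyadic_partial E m + 2^-1 ^+ E m <= dyadic_sum E /\
  dyadic_sum E <= dyadic_partial E m + 2 * 2^-1 ^+ E m.
Proof.
move=> Einc; set s := dyadic_partial E.
have sS n : s n.+1 = s n + 2^-1 ^+ E n by rewrite /s /dyadic_partial big_ord_recr.
(* [v] adds to the partial sum a geometric bound for all remaining terms; it is nonincreasing, so
   each [v k] bounds every partial sum. *)
pose v n := s n + 2 * 2^-1 ^+ E n.
have vS n : v n.+1 <= v n.
  rewrite /v sS; have := dyadic_le (Einc n); rewrite exprS; lra.
have v_le n k : v (k + n)%N <= v n.
  by elim: k => // k /(le_trans _); apply; exact: vS.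
have s_le n k : s n <= s (k + n)%N.
  by elim: k => // k /le_trans; apply; rewrite addSn sS; have := dyadic_gt0 (E (k + n)); lra.
have sv n k : s n <= v k.
  have := s_le n k; have := v_le k n; rewrite addnC /v.
  by have := dyadic_gt0 (E (k + n)); lra.
split.
- rewrite -sS; apply: ub_le_sup; last by exists m.+1.
  by exists (v 0%N) => _ [n _ <-].
- by apply: ge_sup; [exists (s 0%N), 0%N|move=> _ [n _ <-]; exact: sv].
Qed.

Lemma leq_increasing E m : (forall n, E n < E n.+1)%N -> (m <= E m)%N.
Proof. by move=> Einc; elim: m => // m IH; exact: leq_ltn_trans IH (Einc m). Qed.

Lemma dyadic_sum_close E E' m : (forall n, E n < E n.+1)%N ->
  (forall n, E' n < E' n.+1)%N -> (forall n, (n < m)%N -> E n = E' n) ->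
  `|dyadic_sum E - dyadic_sum E'| <= 2 * 2^-1 ^+ m.
Proof.
move=> Einc Einc' EE'.
have sE : dyadic_partial E' m = dyadic_partial E m.
  by apply: eq_bigr => j _; rewrite EE'.
have [] := dyadic_sum_bounds m Einc; have [] := dyadic_sum_bounds m Einc'.
rewrite sE; have := dyadic_gt0 (E m); have := dyadic_gt0 (E' m).
have := dyadic_le (leq_increasing m Einc).
have := dyadic_le (leq_increasing m Einc').
by rewrite ler_norml => *; apply/andP; split; lra.
Qed.

(** With a gap of 2, the whole tail of [E'] from [m] on is at most half of the term [2^-1 ^+ E m],
    so it cannot cancel that term. *)
Lemma dyadic_sum_first_difference E E' m : (forall n, E n < E n.+1)%N ->
  (forall n, E' n < E' n.+1)%N -> (forall n, (n < m)%N -> E n = E' n) ->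
  (E m + 2 <= E' m)%N ->
  2^-1 ^+ E m / 2 <= `|dyadic_sum E - dyadic_sum E'| <= 2 * 2^-1 ^+ E m.
Proof.
move=> Einc Einc' EE' gap.
have sE : dyadic_partial E' m = dyadic_partial E m.
  by apply: eq_bigr => j _; rewrite EE'.
have [] := dyadic_sum_bounds m Einc; have [] := dyadic_sum_bounds m Einc'.
rewrite sE; have := dyadic_gt0 (E m); have := dyadic_gt0 (E' m).
have := dyadic_le gap; rewrite exprD expr2.
move=> *; rewrite ger0_norm; last by lra.
by apply/andP; split; lra.
Qed.

End DyadicSums.

Section Coding.
Variables (R : realType) (X : pseudoMetricType R) (T : X -> X).
Variables (p : nat -> nat) (i : nat -> X -> nat).
Hypothesis rs : residue_system T p i.

(* The largest modulus smaller than [p n], or [0].  It is a multiple of every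
   smaller modulus but not of [p n], so that a point which is exceptional at a
   late level has residue [0], hence is not exceptional, at the earlier ones. *)
Fixpoint last_modulus (n : nat) : nat :=
  if n is n'.+1 then if p n == p n' then last_modulus n' else p n' else 0%N.

(** The index shift matters: as [last_modulus n < p n], a point exceptional at level [n.+1]
    satisfies [i n x = last_modulus n], a condition shared by two points first distinguished at
    level [n.+1]. *)
Definition exceptional_residue (n : nat) : nat :=
  if n is n'.+1 then last_modulus n' else 0%N.

(** The shift gives the exceptional residue the last position [p n - 1], the only one that a step of
    [T] sends back to 0. *)
Definition position (n : nat) (x : X) : nat :=
  ((i n x + (p n - (exceptional_residue n).+1)) %% p n)%N.

(** Block [n] has room for [p n] positions spaced [n + 2] apart, so the exponents of a point
    increase strictly with the level. *)
Definition block_start (n : nat) : nat := (\sum_(j < n) j.+2 * p j)%N.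

Definition exponent (x : X) (n : nat) : nat :=
  (block_start n + n.+2 * position n x)%N.

Definition coding (x : X) : R := dyadic_sum R (exponent x).

(** * Divisibility of the moduli and exceptional levels *)

Lemma modulus_leS n : (p n <= p n.+1)%N.
Proof. exact: dvdn_leq (modulus_gt0 rs _) (modulus_dvd rs n). Qed.

Lemma last_modulus_lt n : (last_modulus n < p n)%N.
Proof.
elim: n => [|n IH] /=; first by rewrite (modulus0 rs).
by case: eqP => [->//|]; have := modulus_leS n; lia.
Qed.

Lemma last_modulus_gt0 n : (1 < p n)%N -> (0 < last_modulus n)%N.
Proof.
elim: n => [|n IH] /=; first by rewrite (modulus0 rs).
by case: eqP => [->//|_ _]; exact: modulus_gt0 rs _.
Qed.

Lemma modulus_dvdW n k : (p n %| p (k + n))%N.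
Proof. by elim: k => // k /dvdn_trans; apply; exact: modulus_dvd rs _. Qed.

Lemma modulus_dvd_last n k : (p n < p (k + n))%N -> (p n %| last_modulus (k + n))%N.
Proof.
elim: k => [|k IH]; first by rewrite ltnn.
rewrite addSn /=; case: eqP => [->//|_ _]; exact: modulus_dvdW.
Qed.

Lemma residue_modW n k x : i n x = (i (k + n) x %% p n)%N.
Proof.
elim: k => [|k ->]; first by rewrite modn_small// (residue_lt rs).
by rewrite (residue_mod rs (k + n)) modn_dvdm// modulus_dvdW.
Qed.

(** Since [p n] divides [last_modulus (k + n)], the residue of [x] at level [n] is 0; but
    [last_modulus n] is positive as soon as [p n > 1]. *)
Lemma exceptional_levels n k x : (0 < k)%N -> (p n < p n.+1)%N ->
  i n x = last_modulus n -> i (k + n) x = last_modulus (k + n) -> p n = 1%N.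
Proof.
case: k => // k _ pn inE ikE.
have pnk : (p n < p (k.+1 + n))%N.
  apply: leq_trans pn (dvdn_leq (modulus_gt0 rs _) _).
  by rewrite addSnnS; exact: modulus_dvdW.
have := residue_modW n k.+1 x.
rewrite ikE inE (eqP (modulus_dvd_last pnk)) => w0.
by have := @last_modulus_gt0 n; have := modulus_gt0 rs n; rewrite w0; lia.
Qed.

(** Only levels where the modulus grows can separate points. Three exceptional ones [a < b < c] are
    impossible: [b] and [c] force [p b = 1], whereas [p a.+1 > 1] divides [p b]. *)
Lemma eventually_regular x : exists N, forall n, (N <= n)%N ->
  (p n < p n.+1)%N -> i n x <> last_modulus n.
Proof.
apply: contrapT => H.
have {}H N : exists n, [/\ (N <= n)%N, (p n < p n.+1)%N & i n x = last_modulus n].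
  apply: contrapT => K; apply: H; exists N => n Nn pn iE.
  by apply: K; exists n.
have [a [_ pa ia]] := H 0%N; have [b [ab pb ib]] := H a.+1.
have [c [bc pc ic]] := H b.+1.
have := @exceptional_levels b (c - b) x; rewrite subnK ?(ltnW bc)// subn_gt0.
move=> /(_ bc pb ib ic) pb1.
have := modulus_dvdW a.+1 (b - a.+1).
rewrite subnK// => /(dvdn_leq (modulus_gt0 rs b)); have := modulus_gt0 rs a; lia.
Qed.

Lemma exceptional_residue_lt n : (exceptional_residue n < p n)%N.
Proof.
case: n => [|n] /=; first by rewrite (modulus0 rs).
exact: leq_trans (last_modulus_lt n) (modulus_leS n).
Qed.

Lemma position_lt n x : (position n x < p n)%N.
Proof. by rewrite ltn_pmod// (modulus_gt0 rs). Qed.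

Lemma position_inj n x y : position n x = position n y -> i n x = i n y.
Proof.
move=> /eqP; rewrite eqn_modDr !modn_small ?(residue_lt rs)// => /eqP//.
Qed.

Lemma position_step n x : i n x <> exceptional_residue n ->
  position n (T x) = (position n x).+1.
Proof.
move=> ine; have pE : position n (T x) = ((position n x).+1 %% p n)%N.
  rewrite /position (residue_step rs) modnDml -[in RHS]addn1 modnDml addn1.
  by rewrite addSn.
rewrite pE modn_small//; move: (position_lt n x); rewrite leq_eqVlt => /orP[/eqP E|//].
case: ine; have pn0 := modulus_gt0 rs n.
have en := exceptional_residue_lt n.
have : ((i n x + (p n - (exceptional_residue n).+1)) ==
   (exceptional_residue n + (p n - (exceptional_residue n).+1)) %[mod p n])%N.
  rewrite -/(position n x) (_ : position n x = (p n).-1)%N; last by rewrite -E.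
  rewrite (_ : exceptional_residue n + _ = (p n).-1)%N; last by lia.
  by rewrite modn_small// ltn_predL.
by rewrite eqn_modDr !modn_small ?(residue_lt rs)// => /eqP.
Qed.

Lemma block_startS n : block_start n.+1 = (block_start n + n.+2 * p n)%N.
Proof. by rewrite /block_start big_ord_recr. Qed.

Lemma exponent_ltS x n : (exponent x n < block_start n.+1)%N.
Proof. by rewrite block_startS ltn_add2l ltn_mul2l position_lt. Qed.

Lemma exponent_increasing x n : (exponent x n < exponent x n.+1)%N.
Proof. exact: leq_trans (exponent_ltS x n) (leq_addr _ _). Qed.

Lemma block_start_le m n : (m <= n)%N -> (block_start m <= block_start n)%N.
Proof.
move=> /subnK <-; elim: (n - m)%N => // k /leq_trans; apply.
by rewrite addSn block_startS leq_addr.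
Qed.

Lemma exponent_eq n x y : i n x = i n y -> exponent x n = exponent y n.
Proof. by rewrite /exponent /position => ->. Qed.

Lemma first_difference x y : x <> y -> exists n, i n.+1 x <> i n.+1 y /\
  forall j, (j <= n)%N -> i j x = i j y.
Proof.
move=> xy; have ex_n : exists n, i n x != i n y.
  apply: contrapT => /forallNP H; apply: xy; apply: (residue_sep rs) => n.
  by have /negP := H n; rewrite negbK => /eqP.
have [[|n] nE nmin] := ex_minnP ex_n.
  have := residue_lt rs 0 x; have := residue_lt rs 0 y.
  by rewrite (modulus0 rs); move/eqP: nE; lia.
exists n; split; first exact/eqP.
by move=> j jn; apply/eqP; apply: contraT => /nmin; lia.
Qed.

(** * Metric estimates for the coding map *)

Lemma coding_first_difference n x y : (forall j, (j < n)%N -> i j x = i j y) ->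
  (position n x < position n y)%N ->
  2^-1 ^+ exponent x n / 2 <= `|coding x - coding y| <= 2 * 2^-1 ^+ exponent x n.
Proof.
move=> agree lt; apply: dyadic_sum_first_difference; try exact: exponent_increasing.
- by move=> j /agree /exponent_eq.
- by rewrite /exponent -addnA leq_add2l; nia.
Qed.

(** The bound depends on the level alone, so close codes force a late first difference. *)
Lemma coding_separated n x y : (forall j, (j < n)%N -> i j x = i j y) ->
  i n x <> i n y -> 2^-1 ^+ block_start n.+1 / 2 <= `|coding x - coding y|.
Proof.
move=> agree nE; wlog lt : x y agree nE / (position n x < position n y)%N.
  move=> W; have [lt|] := ltnP (position n x) (position n y); first exact: W lt.
  rewrite leq_eqVlt => /orP[/eqP/position_inj/esym//|lt].
  by rewrite distrC; apply: W lt => // [j jn|/esym//]; rewrite agree.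
have /andP[+ _] := coding_first_difference agree lt.
apply: le_trans; rewrite ler_pM2r ?invr_gt0//.
by apply: dyadic_le; exact/ltnW/exponent_ltS.
Qed.

Lemma coding_inj : injective coding.
Proof.
move=> x y hxy; apply: contrapT => /first_difference[n [nE agree]].
have := @coding_separated n.+1 x y agree nE.
by rewrite hxy subrr normr0; have := dyadic_gt0 R (block_start n.+2); lra.
Qed.

Lemma coding_continuous : continuous coding.
Proof.
move=> x; apply/cvgrPdist_le => e e0.
have e20 : 0 < e / 2 by lra.
have [N Ne] := dyadic_small e20.
have : \forall y \near x, forall j : 'I_N, i j y = i j x.
  by apply: filter_forall => j; exact: residue_near rs _ _.
apply: filterS => y xy; apply: (@le_trans _ _ (2 * 2^-1 ^+ N)); last by lra.
apply: dyadic_sum_close; try exact: exponent_increasing.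
by move=> j jN; apply/esym/exponent_eq; exact: (xy (Ordinal jN)).
Qed.

Lemma coding_bounds x : 0 <= coding x <= 2.
Proof.
have [] := dyadic_sum_bounds R 0 (exponent_increasing x).
rewrite /dyadic_partial big_ord0 !add0r -/(coding x).
have := dyadic_gt0 R (exponent x 0); have := dyadic_le R (leq0n (exponent x 0)).
by rewrite expr0 => *; apply/andP; split; lra.
Qed.

Lemma first_difference_modulus n x y : i n x = i n y -> i n.+1 x <> i n.+1 y ->
  (p n < p n.+1)%N.
Proof.
move=> nE nSE; rewrite ltn_neqAle modulus_leS andbT; apply/eqP => pn; apply: nSE.
have := nE; rewrite (residue_mod rs n x) (residue_mod rs n y) pn.
by rewrite !modn_small ?(residue_lt rs).
Qed.

(** Both positions at level [n.+1] move up by one without wrapping, so the leading term gains the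
    factor [2 ^- (n + 3)]; the two-sided estimates cost a factor 4. *)
Lemma coding_contracts_at n x y : (forall j, (j <= n)%N -> i j x = i j y) ->
  i n.+1 x <> i n.+1 y -> i n x <> last_modulus n ->
  `|coding (T x) - coding (T y)| <= 2^-1 ^+ n * `|coding x - coding y|.
Proof.
move=> agree nE reg.
wlog lt : x y agree nE reg / (position n.+1 x < position n.+1 y)%N.
  move=> W; have [lt|] := ltnP (position n.+1 x) (position n.+1 y); first exact: W lt.
  rewrite leq_eqVlt => /orP[/eqP/position_inj/esym//|lt].
  rewrite distrC [`|coding x - _|]distrC; apply: (W y x) => //.
  - by move=> j jn; rewrite agree.
  - by move/esym.
  - by rewrite -agree.
have regular z : i n z = i n x -> i n.+1 z <> exceptional_residue n.+1.
  by move=> zE E; apply: reg; rewrite -zE (residue_mod rs) E modn_small// last_modulus_lt.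
have px := position_step (regular x erefl).
have py := position_step (regular y (esym (agree n (leqnn n)))).
have agreeT j : (j < n.+1)%N -> i j (T x) = i j (T y).
  by move=> jn; rewrite !(residue_step rs) agree.
have ltT : (position n.+1 (T x) < position n.+1 (T y))%N by rewrite px py.
have /andP[lo _] := @coding_first_difference n.+1 _ _ agree lt.
have /andP[_ hi] := @coding_first_difference n.+1 _ _ agreeT ltT.
have ET : exponent (T x) n.+1 = (exponent x n.+1 + n.+3)%N.
  by rewrite /exponent px mulnS; lia.
apply: (le_trans hi); rewrite ET exprD.
have := ler_wpM2l (ltW (dyadic_gt0 R n)) lo; rewrite !exprS.
have := mulr_gt0 (dyadic_gt0 R n) (dyadic_gt0 R (exponent x n.+1)); lra.
Qed.

Lemma coding_contracts x (e : R) : 0 < e -> exists2 d : R, 0 < d &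
  forall y, `|coding y - coding x| < d ->
    `|coding (T y) - coding (T x)| <= e * `|coding y - coding x|.
Proof.
move=> e0; have [N HN] := eventually_regular x.
have [N' HN'] := dyadic_small e0.
pose N2 := maxn N N'.
(* By [coding_separated], a point [y <> x] with code this close first differs from [x] at level
   [N2.+1] or later. *)
exists (2^-1 ^+ block_start N2.+1 / 2).
  by have := dyadic_gt0 R (block_start N2.+1); lra.
move=> y yx; have [->|/nesym/first_difference[n [nE agree]]] := pselect (y = x).
  by rewrite !subrr normr0 mulr0.
have [Nn|nN] := leqP N2 n.
- have regx : i n x <> last_modulus n.
    apply: HN; first by rewrite (leq_trans (leq_maxl _ _) Nn).
    exact: first_difference_modulus (agree _ _) nE.
  rewrite distrC [`|coding y - _|]distrC.
  apply: (le_trans (coding_contracts_at agree nE regx)).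
  apply: ler_wpM2r => //; apply: le_trans HN'; apply: dyadic_le.
  exact: leq_trans (leq_maxr _ _) Nn.
- have := @coding_separated n.+1 x y agree nE.
  have := dyadic_le R (@block_start_le n.+2 N2.+1 nN).
  rewrite distrC; lra.
Qed.

End Coding.

(** * Extension across gaps *)

Lemma closed_has_max (R : realType) (B : set R) :
  closed B -> has_sup B -> B (sup B).
Proof.
move=> clB supB; apply: clB => V /nbhs_ballP[e /= e0 eV].
have [b Bb be] := sup_adherent e0 supB.
exists b; split=> //; apply: eV; rewrite /ball /=.
have bs := sup_upper_bound supB Bb.
rewrite ger0_norm ?subr_ge0//; lra.
Qed.

Lemma closed_has_min (R : realType) (B : set R) :
  closed B -> has_inf B -> B (inf B).
Proof.
move=> clB infB; apply: clB => V /nbhs_ballP[e /= e0 eV].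
have [b Bb be] := inf_adherent e0 infB.
exists b; split=> //; apply: eV; rewrite /ball /= distrC.
have bs := ge_inf infB.2 Bb.
rewrite ger0_norm ?subr_ge0//; lra.
Qed.

(** * Cubic interpolation *)

Definition smoothstep {R : realType} (u : R) : R := u ^+ 2 * (3 - 2 * u).

Lemma smoothstep_bounds (R : realType) (u : R) : 0 <= u -> u <= 1 ->
  [/\ 0 <= smoothstep u, smoothstep u <= 1 & smoothstep u <= 3 * u ^+ 2].
Proof.
move=> u0 u1; rewrite /smoothstep; split.
- by apply: mulr_ge0; [exact: sqr_ge0|lra].
- rewrite -subr_ge0.
  have -> : 1 - u ^+ 2 * (3 - 2 * u) = (1 - u) ^+ 2 * (1 + 2 * u) by ring.
  by apply: mulr_ge0; [exact: sqr_ge0|lra].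
- by rewrite mulrC ler_wpM2r ?sqr_ge0//; lra.
Qed.

(** This symmetry lets a gap be read from either end. *)
Lemma smoothstepN (R : realType) (u : R) :
  smoothstep (1 - u) = 1 - smoothstep u.
Proof. by rewrite /smoothstep; ring. Qed.

(** For [y] in a gap with near end [c] and far end [d] as seen from [x], the letters [s], [t], [D]
    stand for [|c - x|], [|y - c|], [|d - c|], and [P], [Q] for [|f c - f x|], [|f d - f c|]. Here
    [d] too is close to [x], and [D * smoothstep (t / D) <= 3 * t] suffices. *)
Lemma smoothstep_chord_small (R : realType) (e s t D P Q : R) :
  0 <= e -> 0 <= s -> 0 <= t -> 0 < D -> t <= D -> P <= e * s ->
  Q <= e * (2 * s + D) -> P + Q * smoothstep (t / D) <= 3 * e * (s + t).
Proof.
move=> e0 s0 t0 D0 tD Ps QD.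
have tE : t = t / D * D by rewrite divfK ?gt_eqF.
set u := t / D in tE *.
have u0 : 0 <= u by rewrite divr_ge0// ltW.
have u1 : u <= 1 by rewrite ler_pdivrMr// mul1r.
have [p0 p1 p3] := smoothstep_bounds u0 u1.
set p := smoothstep u in p0 p1 p3 *.
have pD : p * D <= 3 * t.
  rewrite tE; have : p <= 3 * u by nra.
  by move=> pu; have := ler_wpM2r (ltW D0) pu; lra.
have := ler_wpM2r p0 QD.
have : e * (p * D) <= e * (3 * t) by apply: ler_wpM2l.
have : e * s * p <= e * s * 1 by apply: ler_wpM2l => //; exact: mulr_ge0.
lra.
Qed.

(** Here [d] is far, and only the displacement bound [M] controls [f d]; the quadratic decay of
    [smoothstep] in [t / D] compensates once [t] is small against [L]. *)
Lemma smoothstep_chord_large (R : realType) (e M L s t D P Q : R) :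
  0 < e -> 0 <= M -> 0 < L -> 0 <= s -> 0 <= t -> L <= D -> t <= D ->
  P <= e * s -> Q <= 2 * M + D -> t * (3 * (2 * M / L ^+ 2 + L^-1)) <= e ->
  P + Q * smoothstep (t / D) <= 3 * e * (s + t).
Proof.
move=> e0 M0 L0 s0 t0 LD tD Ps QD te.
have D0 : 0 < D by lra.
have u0 : 0 <= t / D by rewrite divr_ge0// ltW.
have u1 : t / D <= 1 by rewrite ler_pdivrMr// mul1r.
have [p0 _ p3] := smoothstep_bounds u0 u1.
set p := smoothstep _ in p0 p3 *.
have DL : D^-1 <= L^-1 by rewrite lef_pV2 ?posrE.
have Di : 0 < D^-1 by rewrite invr_gt0.
have h1 : Q * p <= (2 * M + D) * (3 * (t / D) ^+ 2).
  by apply: (le_trans (ler_wpM2r p0 QD)); apply: ler_wpM2l => //; lra.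
have h2 : (2 * M + D) * (3 * (t / D) ^+ 2)
    = t * (t * (3 * (2 * M / D ^+ 2 + D^-1))).
  by field; rewrite gt_eqF.
have h3 : 3 * (2 * M / D ^+ 2 + D^-1) <= 3 * (2 * M / L ^+ 2 + L^-1).
  apply: ler_wpM2l; first by []. 
  apply: lerD; last by []. 
 apply: ler_wpM2l; first by lra.
  rewrite lef_pV2 ?posrE ?exprn_gt0//.
  have ->: D ^+ 2 = L ^+ 2 + (D - L) * (D + L) by ring.
  by rewrite lerDl mulr_ge0; lra.
have h4 : t * (t * (3 * (2 * M / D ^+ 2 + D^-1))) <= t * e.
  exact: ler_wpM2l t0 _ _ (le_trans (ler_wpM2l t0 h3) te).
have : 0 <= e * s by apply: mulr_ge0 => //; exact: ltW.
have : 0 <= e * t by apply: mulr_ge0 => //; exact: ltW.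
lra.
Qed.

Lemma derivable_of_small_slope (R : realType) (F : R -> R) (x : R) :
  (forall e : R, 0 < e -> exists2 d : R, 0 < d &
     forall y, `|y - x| < d -> `|F y - F x| <= e * `|y - x|) ->
  derivable F x 1.
Proof.
move=> H; apply/cvg_ex; exists (0 : R); apply/cvgrPdist_le => e e0.
have [d d0 Hd] := H _ e0.
near=> k; rewrite sub0r normrN /=.
have k0 : k != 0 by near: k; exact: nbhs_dnbhs_neq.
have kd : `|k| < d.
  near: k; apply: nbhs_dnbhs; apply/nbhs_ballP; exists d => //= k.
  by rewrite /ball /= sub0r normrN.
have := Hd (k + x); rewrite addrK => /(_ kd).
by rewrite [k *: _]mulr1 normrZ normfV ler_pdivrMl ?normr_gt0// [e * _]mulrC.
Unshelve. all: by end_near. Qed.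

(** * Interpolation over the gaps of a closed set *)

Section GapExtension.
Variables (R : realType) (A : set R) (f : R -> R).

Definition gap_left (y : R) : R := sup (A `&` [set x | x <= y]).
Definition gap_right (y : R) : R := inf (A `&` [set x | y <= x]).

(* On [A] itself the fraction is [0 / 0 = 0], so the value is that of [f]. *)
Definition gap_extension (y : R) : R :=
  f (gap_left y) + (f (gap_right y) - f (gap_left y)) *
    smoothstep ((y - gap_left y) / (gap_right y - gap_left y)).

Hypothesis clA : closed A.
Hypothesis unb_l : forall y, exists2 a, A a & a <= y.
Hypothesis unb_r : forall y, exists2 b, A b & y <= b.

Lemma gap_leftP y : [/\ A (gap_left y), gap_left y <= y &
  forall x, A x -> x <= y -> x <= gap_left y].
Proof.
have hs : has_sup (A `&` [set x | x <= y]).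
  split; first by have [a Aa ay] := unb_l y; exists a.
  by exists y => x [].
have cl : closed (A `&` [set x | x <= y]) by apply: closedI => //; exact: closed_le.
have [? ?] := closed_has_max cl hs.
by split=> // x Ax xy; apply: (sup_upper_bound hs).
Qed.

Lemma gap_rightP y : [/\ A (gap_right y), y <= gap_right y &
  forall x, A x -> y <= x -> gap_right y <= x].
Proof.
have hs : has_inf (A `&` [set x | y <= x]).
  split; first by have [a Aa ay] := unb_r y; exists a.
  by exists y => x [].
have cl : closed (A `&` [set x | y <= x]) by apply: closedI => //; exact: closed_ge.
have [? ?] := closed_has_min cl hs.
by split=> // x Ax xy; apply: (ge_inf hs.2).
Qed.

Lemma gap_left_id y : A y -> gap_left y = y.
Proof. by move=> Ay; have [_ ? /(_ y Ay)] := gap_leftP y; lra. Qed.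

Lemma gap_extensionE y : A y -> gap_extension y = f y.
Proof.
by move=> Ay; rewrite /gap_extension gap_left_id// subrr mul0r /smoothstep
  expr0n mul0r mulr0 addr0.
Qed.

Lemma in_gap y : ~ A y -> gap_left y < y < gap_right y.
Proof.
move=> nA; have [Al ly _] := gap_leftP y; have [Ar yr _] := gap_rightP y.
rewrite !lt_neqAle ly yr !andbT; apply/andP; split; apply/eqP => E; apply: nA.
  by rewrite -E.
by rewrite E.
Qed.

Lemma gap_locally_constant y z : ~ A y -> gap_left y < z < gap_right y ->
  gap_left z = gap_left y /\ gap_right z = gap_right y.
Proof.
move=> nA /andP[lz zr].
have [Al ly lM] := gap_leftP y; have [Ar yr rm] := gap_rightP y.
have [Al' ly' lM'] := gap_leftP z; have [Ar' yr' rm'] := gap_rightP z.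
have := lM' _ Al (ltW lz); have := rm' _ Ar (ltW zr).
have [H|H] := leP (gap_left z) y; have [K|K] := leP y (gap_right z).
- by have := lM _ Al' H; have := rm _ Ar' K; lra.
- by have := lM _ Ar' (ltW K); lra.
- by have := rm _ Al' (ltW H); lra.
- by lra.
Qed.

Lemma derivable_gap_extension_off y : ~ A y -> derivable gap_extension y 1.
Proof.
move=> nA; set l := gap_left y; set r := gap_right y.
(* Near [y] the gap ends stay fixed, so the extension coincides with a polynomial. *)
pose u : {poly R} := ('X - l%:P) * ((r - l)^-1)%:P.
pose p : {poly R} := (f l)%:P + (f r - f l)%:P * (u ^+ 2 * (3%:P - 2%:P * u)).
apply: (@near_eq_derivable _ _ _ (horner p)); last exact: derivable_horner.
have /andP[ly yr] := in_gap nA.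
near=> z; rewrite /gap_extension /smoothstep.
have [|-> ->] := @gap_locally_constant y z nA; last by rewrite /p /u !hornerE.
apply/andP; split; near: z; [exact: lt_nbhsr|exact: lt_nbhsl].
Unshelve. all: by end_near. Qed.

Hypothesis fd : forall x, A x -> forall e : R, 0 < e -> exists2 d : R, 0 < d &
  forall y, A y -> `|y - x| < d -> `|f y - f x| <= e * `|y - x|.
Variable M : R.
Hypothesis fM : forall x, A x -> `|f x - x| <= M.

(* [c] is the endpoint of the gap around [y] on the side of [x]. *)
Lemma gap_extension_chord x y : A x -> ~ A y -> exists c d : R,
  [/\ A c /\ A d, `|y - x| = `|c - x| + `|y - c|, `|d - x| = `|c - x| + `|d - c|,
     `|y - c| < `|d - c| &
     gap_extension y = f c + (f d - f c) * smoothstep (`|y - c| / `|d - c|)].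
Proof.
move=> Ax nAy; have /andP[ly yr] := in_gap nAy.
have [Al _ lM] := gap_leftP y; have [Ar _ rm] := gap_rightP y.
rewrite /gap_extension; set l := gap_left y in ly Al lM *.
set r := gap_right y in yr Ar rm *.
have [xy|yx] := leP x y.
- have xl := lM _ Ax xy; exists l, r.
  by rewrite !ger0_norm ?subr_ge0; try lra; split=> //; lra.
- have rx := rm _ Ax (ltW yx); exists r, l.
  rewrite !ler0_norm ?subr_le0; try lra; split=> //; try lra.
  have -> : - (y - r) / - (l - r) = 1 - (y - l) / (r - l).
    by field; apply/andP; split; rewrite subr_eq0; [|rewrite eq_sym]; lra.
  by rewrite smoothstepN; ring.
Qed.

Lemma derivable_gap_extension_on x : A x -> derivable gap_extension x 1.
Proof.
move=> Ax; apply: derivable_of_small_slope => e e0.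
have e30 : 0 < e / 3 by lra.
have [d0 d0p Hd] := fd Ax e30.
have M0 : 0 <= M by apply: le_trans (normr_ge0 _) (fM Ax).
(* If [y] is within [L] of [x] and the far end of its gap is at least [d0] from [x], the gap is at
   least [L] long. *)
pose L := d0 / 2; have L0 : 0 < L by rewrite /L; lra.
pose K := 3 * (2 * M / L ^+ 2 + L^-1).
have K0 : 0 < K.
  have : 0 < L^-1 by rewrite invr_gt0.
  have : 0 <= 2 * M / L ^+ 2 by apply: divr_ge0; [lra|exact: sqr_ge0].
  by rewrite /K; lra.
exists (Num.min L (e / 3 / K)); first by rewrite lt_min L0 divr_gt0.
move=> y; rewrite lt_min => /andP[yL yK].
rewrite (gap_extensionE Ax).
have [Ay|nAy] := pselect (A y).
  rewrite gap_extensionE//; apply: (le_trans (Hd _ Ay _)); first by rewrite /L in yL; lra.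
  by apply: ler_wpM2r => //; lra.
have [c [d [[Ac Ad] yxE dxE ycd ->]]] := gap_extension_chord Ax nAy.
have cx0 := normr_ge0 (c - x); have yc0 := normr_ge0 (y - c).
have D0 : 0 < `|d - c| by lra.
have Hc : `|f c - f x| <= e / 3 * `|c - x| by apply: Hd => //; rewrite /L in yL; lra.
set p := smoothstep _.
have p0 : 0 <= p.
  have u0 : 0 <= `|y - c| / `|d - c| by rewrite divr_ge0.
  have u1 : `|y - c| / `|d - c| <= 1 by rewrite ler_pdivrMr// mul1r ltW.
  by have [] := smoothstep_bounds u0 u1.
apply: (@le_trans _ _ (`|f c - f x| + `|f d - f c| * p)).
  rewrite -{2}(ger0_norm p0) -normrM.
  by rewrite [X in `|X|](_ : _ = (f c - f x) + (f d - f c) * p);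
    [exact: ler_normD|ring].
have -> : e * `|y - x| = 3 * (e / 3) * (`|c - x| + `|y - c|).
  by rewrite yxE; field.
have [dxs|dxl] := ltP (`|d - x|) d0.
- apply: smoothstep_chord_small => //; [lra|lra|].
  have Hdd := Hd _ Ad dxs.
  have := ler_normD (f d - f x) (f x - f c).
  rewrite (_ : f d - f x + (f x - f c) = f d - f c); last by ring.
  by rewrite [`|f x - f c|]distrC; rewrite dxE in Hdd; lra.
- apply: (@smoothstep_chord_large _ _ M L) => //.
  + by rewrite /L in yL *; lra.
  + exact: ltW.
  + have := ler_normD (f d - d) (d - c + (c - f c)).
    have := ler_normD (d - c) (c - f c).
    rewrite [`|c - f c|]distrC.
    rewrite (_ : f d - d + (d - c + (c - f c)) = f d - f c); last by ring.
    by have := fM Ac; have := fM Ad; lra.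
  + by rewrite -/K -ler_pdivlMr//; lra.
Qed.

Lemma differentiable_surjective_extension : exists F : R -> R,
  [/\ (forall x, derivable F x 1), (forall y, exists x, F x = y) &
      (forall x, A x -> F x = f x)].
Proof.
exists gap_extension; have dF x : derivable gap_extension x 1.
  have [Ax|nAx] := pselect (A x).
    exact: derivable_gap_extension_on.
  exact: derivable_gap_extension_off.
split=> //; last by move=> x; exact: gap_extensionE.
move=> y.
(* Displacement at most [M] gives [f a <= y <= f b]. *)
have [a Aa ay] := unb_l (y - M); have [b Ab yb] := unb_r (y + M).
have M0 : 0 <= M by apply: le_trans (normr_ge0 _) (fM Aa).
have Fa : gap_extension a <= y.
  by rewrite gap_extensionE//; have := fM Aa; rewrite ler_norml => /andP[]; lra.
have Fb : y <= gap_extension b.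
  by rewrite gap_extensionE//; have := fM Ab; rewrite ler_norml => /andP[]; lra.
have ab : a <= b by lra.
have [||x _ xy] := @IVT R gap_extension a b y ab.
- apply: continuous_subspaceT => x.
  by apply: differentiable_continuous; apply/derivable1_diffP; exact: dF.
- by rewrite ge_min le_max Fa Fb orbT.
by exists x.
Qed.

End GapExtension.

(** * The conjugacy *)

(** The image of the complement of an open set is compact, hence closed, which makes the inverse
    continuous; [x0] is its default value off the range. *)
Lemma compact_injection_inverse (R : realType) (X : pseudoMetricType R)
    (x0 : X) (h : X -> R) :
  compact [set: X] -> continuous h -> injective h ->
  exists g : R -> X, (forall x, g (h x) = x) /\ {within range h, continuous g}.
Proof.
move=> cX ch ih.
pose g y := xget x0 [set x | h x = y].
have gh x : g (h x) = x.
  by apply: ih; apply: (@xgetPex _ x0 [set z | h z = h x]); exists x.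
exists g; split=> //; apply/subspace_continuousP => _ [a _ <-].
rewrite /from_subspace gh => U Ua; rewrite /fmap /within /=.
have cK : compact (~` U^°).
  apply: (subclosed_compact _ cX) => //; apply: open_closedC; exact: open_interior.
have cl : closed (h @` (~` U^°)).
  apply: compact_closed; first exact: Rhausdorff.
  by apply: continuous_compact => //; exact: continuous_subspaceT.
have nha : nbhs (h a) (~` (h @` (~` U^°))).
  apply: open_nbhs_nbhs; split; first exact: closed_openC.
  by move=> [b nb /ih ba]; apply: nb; rewrite ba.
apply: filterS nha => z nz [b _ bz]; suff: U b by rewrite -{1}(gh b) bz.
apply: contrapT => nU; apply: nz; exists b => // /interior_subset//.
Qed.

(** The range is closed and contains [T^n x0] for [n >= 1]; recurrence brings these iterates back to
    [x0] itself, so the range is also dense. *)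
Lemma odometer_surjective (R : realType) (X : pseudoMetricType R) (T : X -> X) :
  odometer T -> range T = [set: X].
Proof.
move=> [hX cX cT eqT [x0 [rec0 dense0]]].
have cl : closed (range T).
  apply: compact_closed => //.
  by apply: continuous_compact => //; exact: continuous_subspaceT.
apply/seteqP; split=> // y _; apply: cl => V /nbhs_interior Vy.
have [[|n] Vn] := orbit_dense dense0 Vy; last first.
  by exists (iter n.+1 T x0); split; [exists (iter n T x0)|exact: interior_subset Vn].
have [[|q] // _ Hq] := rec0 _ (@open_interior _ V) Vn.
exists (iter q.+1 T x0); split; first by exists (iter q T x0).
by have := Hq 1%N; rewrite mul1n; exact: interior_subset.
Qed.

Lemma closed_integers (R : realType) : closed (range (fun k : int => k%:~R : R)).
Proof.
rewrite -openC openE => x nx; rewrite /interior /=.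
have fx : (Num.floor x)%:~R < x.
  rewrite lt_neqAle Num.Theory.floor_le andbT; apply/eqP => E; apply: nx.
  by exists (Num.floor x).
have xf : x < (Num.floor x + 1)%:~R by exact: floorD1_gt.
near=> z; move=> [k _ kz].
have : (Num.floor x)%:~R < z by near: z; exact: lt_nbhsr.
have : z < (Num.floor x + 1)%:~R by near: z; exact: lt_nbhsl.
rewrite -kz !ltr_int; lia.
Unshelve. all: by end_near. Qed.

Lemma residue_system_injective (R : realType) (X : pseudoMetricType R)
    (T : X -> X) p i : residue_system T p i -> injective T.
Proof.
move=> rs x y Txy; apply: (residue_sep rs) => n.
have := residue_step rs n y; rewrite -Txy (residue_step rs) -[(i n x).+1]addn1.
rewrite -[(i n y).+1]addn1 => /eqP.
by rewrite eqn_modDr !modn_small ?(residue_lt rs)// => /eqP.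
Qed.

Lemma deriv_on_zero_of_small_slope (R : realType) (f : R -> R) (C : set R) (x : R) :
  (forall e : R, 0 < e -> exists2 d : R, 0 < d &
    forall y, C y -> `|y - x| < d -> `|f y - f x| <= e * `|y - x|) ->
  deriv_on_zero f C x.
Proof.
move=> H; apply/cvgrPdist_le => e e0; have [d d0 Hd] := H _ e0.
rewrite near_withinE; near=> y => -[Cy /= yx].
have yx0 : 0 < `|y - x| by rewrite normr_gt0 subr_eq0; exact/eqP.
rewrite sub0r normrN normrM normfV ler_pdivrMr//; apply: Hd; first by [].
by rewrite distrC; near: y; exact: nbhsx_ballx.
Unshelve. all: by end_near. Qed.

Theorem theoremA (R : realType) (X : pseudoMetricType R) (T : X -> X) :
  odometer T ->
  exists (C : set R) (f : R -> R) (h : X -> R),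
    [/\ homeo_of_subset f C,
        homeo_onto h C,
        (forall x : X, h (T x) = f (h x)),
        (forall x : R, C x -> deriv_on_zero f C x) &
        exists F : R -> R,
          [/\ (forall x : R, derivable F x 1),
              (forall y : R, exists x : R, F x = y) &
              (forall x : R, C x -> F x = f x)]].
Proof.
move=> odo; have [_ cX cT _ [x0 _]] := odo.
have [p [i rs]] := odometer_residue_system odo.
have rT := odometer_surjective odo; have iT := residue_system_injective rs.
pose h : X -> R := coding p i.
have ch : continuous h := coding_continuous rs.
have ih : injective h := coding_inj rs.
have hb x : 0 <= h x <= 2 by exact: coding_bounds rs x.
have chT : continuous (h \o T) by move=> x; apply: continuous_comp; [exact: cT|exact: ch].
have ihT : injective (h \o T) by move=> x y /ih/iT.
have [g [gh cg]] := compact_injection_inverse x0 cX ch ih.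
(* [g'] undoes [h \o T], so [h \o g'] will be the continuous inverse of [f]. *)
have [g' [g'h cg']] := compact_injection_inverse x0 cX chT ihT.
have rhT : range (h \o T) = range h.
  apply/seteqP; split=> [_ [a _ <-]|_ [a _ <-]]; first by exists (T a).
  by have [b _ <-] : range T a by [rewrite rT]; exists b.
rewrite rhT in cg'.
pose f := h \o T \o g.
have fh x : f (h x) = h (T x) by rewrite /f /= gh.
have slope x : range h x -> forall e : R, 0 < e -> exists2 d : R, 0 < d &
    forall y, range h y -> `|y - x| < d -> `|f y - f x| <= e * `|y - x|.
  move=> [a _ <-] e e0; have [d d0 Hd] := coding_contracts rs a e0.
  by exists d => // _ [b _ <-] /Hd; rewrite !fh.
have comp_cont (k : X -> R) (l : R -> X) : continuous k ->
    {within range h, continuous l} -> {within range h, continuous (k \o l)}.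
  move=> ck cl x; apply: (@continuous_comp (subspace (range h)) X R l k); first exact: cl.
  exact: ck.
exists (range h), f, h; split=> //.
- split.
  + rewrite -[in RHS]rhT; apply/seteqP; split=> [_ [_ [a _ <-] <-]|_ [a _ <-]].
      by rewrite fh; exists a.
    by exists (h a); [exists a|rewrite fh].
  + move=> x y /set_mem[a _ <-] /set_mem[b _ <-]; rewrite !fh.
    by move=> /ihT ->.
  + exact: comp_cont.
  + exists (h \o g'); split.
    * by move=> x /set_mem[a _ <-]; rewrite fh /= (g'h a).
    * by move=> _ [x _ <-]; exists (g' x).
    * exact: comp_cont.
- by split=> //; exists g.
- by move=> x Cx; apply: deriv_on_zero_of_small_slope; exact: slope.
(* As [range h] lies in [[0, 2]], the added integers are at distance at least 1 from it and from
   each other; being isolated, they satisfy the slope condition with radius 1. *)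
pose A := range h `|` (range (fun k : int => k%:~R : R) `&` [set x | 3 <= `|x|]).
pose fA (x : R) := if 3 <= `|x| then x else f x.
have fAh x : range h x -> fA x = f x.
  move=> [a _ <-]; rewrite /fA; have /andP[h0 h2] := hb a.
  by rewrite ger0_norm// leNgt (le_lt_trans h2)// ltr_nat.
have far_int (k l : int) : `|l%:~R - k%:~R : R| < 1 -> l = k.
  by rewrite -intrB -intr_norm -[ltRHS](mulr1z (1 : R)) ltr_int; lia.
have far_norm (k : int) : (3 <= `|k|)%N -> A k%:~R.
  move=> k3; right; split; first by exists k.
  by rewrite /= -intr_norm -[3]/(3%:~R : R) ler_int; lia.
have near_A x y : A x -> A y -> `|y - x| < 1 -> (range h x /\ range h y) \/ y = x.
  have sep (a : X) (z : R) : 3 <= `|z| -> 1 <= `|z - h a|.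
    move=> z3; have /andP[a0 a2] := hb a; have := ler_normD (z - h a) (h a).
    by rewrite subrK (ger0_norm a0); lra.
  move=> [[a _ <-]|[[k _ <-] k3]] [[b _ <-]|[[l _ <-] l3]] xy.
  - by left; split; [exists a|exists b].
  - by have := sep a _ l3; lra.
  - by have := sep b _ k3; rewrite distrC; lra.
  - by right; rewrite (far_int _ _ xy).
(* The displacement bound 3 is safe: [x] and [f x] both lie in [[0, 2]] on [range h], and [fA] fixes
   the integers. *)
have [||||x Ax|F [dF sF FA]] :=
    @differentiable_surjective_extension R A fA _ _ _ _ 3.
- apply: closedU.
    by apply: compact_closed; [exact: Rhausdorff|apply: continuous_compact => //;
      exact: continuous_subspaceT].
  apply: closedI; first exact: closed_integers.
  by apply: (closed_comp _ (@closed_ge R 3)) => x _; exact: norm_continuous.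
(* This integer is at most both [y] and [-3], whatever the sign of [y]. *)
- move=> y; exists (Num.floor y - `|Num.floor y| - 3)%:~R.
    by apply: far_norm; lia.
  apply: (le_trans _ (Num.Theory.floor_le y)); rewrite ler_int; move: (Num.floor y) => k; lia.
- move=> y; exists (Num.floor y + 1 + `|Num.floor y| + 3)%:~R.
    by apply: far_norm; lia.
  by apply: (le_trans (ltW (floorD1_gt y))); rewrite ler_int;
  move: (Num.floor y) => k; lia.
- move=> x Ax e e0; have [hx|nhx] := pselect (range h x).
    have [d d0 Hd] := slope x hx e e0.
    exists (Num.min d 1); first by rewrite lt_min d0 ltr01.
    move=> y Ay; rewrite lt_min => /andP[yd y1].
    have [[_ hy]|->] := near_A x y Ax Ay y1; last by rewrite !subrr normr0 mulr0.
    by rewrite !fAh//; exact: Hd.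
  exists 1 => // y Ay y1.
  have [[/nhx//]|->] := near_A x y Ax Ay y1; last by rewrite !subrr normr0 mulr0.
- case: Ax => [hx|[_ /= x3]]; last by rewrite /fA x3 subrr normr0.
  rewrite fAh//; case: hx => a _ <-; rewrite fh.
  have /andP[] := hb a; have /andP[] := hb (T a).
  by rewrite ler_norml => *; apply/andP; split; lra.
by exists F; split=> // x Cx; rewrite FA ?fAh//; left.
Qed.
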